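(* Let $\Phi$ be a homogeneous Poisson point process on $\mathbb{R}^2$ with intensity $\lambda>0$, and let $\boldsymbol{x}_{\rm s},\boldsymbol{x}_{\rm d}\in\mathbb{R}^2$ be two points at Euclidean distance $2d$ with $d>0$. Let $\Gamma_{\rm opt}=\min_{\boldsymbol{X}\in\Phi}\widehat{s}(\boldsymbol{X})$, where $\widehat{s}(\boldsymbol{x})=\max\{\|\boldsymbol{x}_{\rm s}-\boldsymbol{x}\|,\|\boldsymbol{x}-\boldsymbol{x}_{\rm d}\|\}$. Then the cumulative distribution function $F_{\Gamma_{\rm opt}}$ and the probability density function $f_{\Gamma_{\rm opt}}$ of $\Gamma_{\rm opt}$ are given by $$F_{\Gamma_{\rm opt}}(\gamma)=\begin{cases}0 & \text{if }\gamma<d,\\ 1-\exp\left(-2\lambda d^2\left(\left(\frac{\gamma}{d}\right)^2\operatorname{arcsec}\left(\frac{\gamma}{d}\right)-\sqrt{\left(\frac{\gamma}{d}\right)^2-1}\right)\right) & \text{if }\gamma\ge d,\end{cases}$$ and $$f_{\Gamma_{\rm opt}}(\gamma)=4\lambda\gamma\operatorname{arcsec}\left(\frac{\gamma}{d}\right)\exp\left(-2\lambda d^2\left(\left(\frac{\gamma}{d}\right)^2\operatorname{arcsec}\left(\frac{\gamma}{d}\right)-\sqrt{\left(\frac{\gamma}{d}\right)^2-1}\right)\right)\mathbf{1}_{\{\gamma\ge d\}}.$$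
   Context: $\|\cdot\|$ is the Euclidean norm on $\mathbb{R}^2$. $\operatorname{arcsec}(u)=\arccos(1/u)$ for $u\ge 1$. $\mathbf{1}_{\{\cdot\}}$ denotes an indicator function. Interpretation: $\boldsymbol{x}_{\rm s}$ and $\boldsymbol{x}_{\rm d}$ are source and destination locations and $\Phi$ is the random set of relay locations; since $\Phi$ is almost surely nonempty and locally finite, the minimum defining $\Gamma_{\rm opt}$ is attained almost surely. *)

(* Defs.v *)
(* MathComp-Analysis, over an arbitrary [R : realType]. *)
From HB Require Import structures.
From mathcomp Require Import all_boot all_order all_algebra.
From mathcomp Require Import all_classical all_reals all_analysis.
From mathcomp Require Import measurable_realfun.
Import Order.TTheory GRing.Theory Num.Theory numFieldNormedType.Exports.

Set Implicit Arguments.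
Unset Strict Implicit.
Unset Printing Implicit Defensive.

Local Open Scope classical_set_scope.
Local Open Scope ring_scope.

Section Plane.
Context {R : realType}.
Implicit Types x : R * R.

(* The library norm on [R * R] is the sup norm; it is only used below in
   [bounded_set], where it makes no difference. *)
Definition enorm x : R := Num.sqrt (x.1 ^+ 2 + x.2 ^+ 2).

Definition area (B : set (R * R)) : \bar R :=
  (@lebesgue_measure R \x @lebesgue_measure R)%E B.

Definition shat xs xd x : R := Num.max (enorm (xs - x)) (enorm (x - xd)).

End Plane.

(* Only meaningful for [1 <= u]. *)
Definition arcsec {R : realType} (u : R) : R := acos u^-1.

Definition is_minimum {R : realType} (A : set R) (m : R) : Prop :=
  A m /\ lbound A m.

Section PointProcess.
Context {R : realType} {disp : measure_display} {Omega : measurableType disp}.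
Variable P : probability Omega R.

(* The product rule over subfamilies follows by taking some [A i] full. *)
Definition mutually_independent {n : nat} (X : 'I_n -> Omega -> \bar R) : Prop :=
  forall A : 'I_n -> set (\bar R), (forall i, measurable (A i)) ->
    P (\bigcap_(i in [set: 'I_n]) X i @^-1` A i)
    = (\prod_(i < n) P (X i @^-1` A i))%E.

(* [+oo] when [Phi w `&` B] is infinite. *)
Definition nb_points (Phi : Omega -> set (R * R)) (B : set (R * R))
  (w : Omega) : \bar R := counting (Phi w `&` B).

Definition locally_finite (S : set (R * R)) : Prop :=
  forall B : set (R * R), bounded_set B -> finite_set (S `&` B).

Definition bounded_borel (B : set (R * R)) : Prop :=
  measurable B /\ bounded_set B.

(* A (simple) point process is given by its random set of points [Phi].  The
   Poisson weights are spelled out because the library's [poisson_pmf] does not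
   degenerate to the Dirac mass at 0 when the mean is 0; here [0 ^+ 0 = 1]. *)
Record homogeneous_poisson (lambda : R) (Phi : Omega -> set (R * R)) : Prop :=
  HomogeneousPoisson {
  hp_locally_finite : {ae P, forall w, locally_finite (Phi w)} ;
  hp_measurable : forall B, bounded_borel B ->
    measurable_fun [set: Omega] (nb_points Phi B) ;
  hp_count : forall B (k : nat), bounded_borel B ->
    let m := lambda * fine (area B) in
    P [set w | nb_points Phi B w = k%:R%:E]
    = (expR (- m) * m ^+ k / k`!%:R)%:E ;
  hp_independent : forall (n : nat) (B : 'I_n -> set (R * R)),
    (forall i, bounded_borel (B i)) -> trivIset [set: 'I_n] B ->
    mutually_independent (fun i => nb_points Phi (B i))
}.

Definition is_pdf (X : {RV P >-> R}) (f : R -> R) : Prop :=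
  [/\ measurable_fun [set: R] f, forall x, 0 <= f x &
   forall A : set R, measurable A ->
     distribution P X A = (\int[lebesgue_measure]_(x in A) (f x)%:E)%E].

End PointProcess.

(* Main.v *)
Require Import Defs.
From HB Require Import structures.
From mathcomp Require Import all_boot all_order all_algebra.
From mathcomp Require Import all_classical all_reals all_analysis.
From mathcomp Require Import measurable_realfun.
From mathcomp Require Import ring lra.
Import Order.TTheory GRing.Theory Num.Theory numFieldNormedType.Exports.

(* The minimum is at most [g] exactly when some relay lies in the lens
   [{x | shat x <= g}], the intersection of the two discs of radius [g] around
   the source and the destination; hence the minimum exceeds [g] with the void
   probability [exp (- lambda * area of the lens)].  A rotation is a product of
   three shears, and a shear preserves the area by Fubini and the translation
   invariance of the Lebesgue measure, so the source and the destination may be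
   placed on the second axis; the area is then an elementary integral, and the
   density is the derivative of the distribution function.  The minimum is
   measurable because it is an infimum over the rational radii whose lens
   contains a relay. *)

Local Open Scope classical_set_scope.
Local Open Scope ring_scope.

(** * Area-preserving maps of the plane *)

Section AreaPreserving.
Context {R : realType}.
Local Notation mu := (@lebesgue_measure R).

(** Translation keeps the length of half-open intervals, and these lengths determine the Lebesgue
    measure. *)
Lemma lebesgue_measure_shift (c : R) (A : set R) : measurable A ->
  mu [set y | A (y + c)] = mu A.
Proof.
move=> mA.
pose f : measurableTypeR R -> measurableTypeR R := fun y => y + c.
have mf : measurable_fun setT f by exact: measurable_funD.
pose F : {mfun measurableTypeR R >-> measurableTypeR R} :=
  HB.pack f (isMeasurableFun.Build _ _ _ _ f mf).
apply/esym; apply: (@lebesgue_measure_unique _ (pushforward mu F)) => //.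
move=> _ [[a b]] _ <-; transitivity (mu `]a - c, b - c]%classic).
  by rewrite !lebesgue_measure_itv/= !lte_fin ltrD2r -!EFinB opprB addrA subrK.
by congr (mu _); apply/seteqP; split => x; rewrite /= /f !in_itv/= ltrBlDr lerBrDr.
Qed.

Definition area_preserving (T : R * R -> R * R) :=
  measurable_fun setT T /\
  forall B, measurable B -> area (T @^-1` B) = area B.

Lemma area_preserving_comp T S : area_preserving T -> area_preserving S ->
  area_preserving (T \o S).
Proof.
move=> [mT aT] [mS aS]; split; first exact: measurableT_comp.
move=> B mB; rewrite comp_preimage aS ?aT//.
by rewrite -[X in measurable X]setTI; exact: mT.
Qed.

(** [area] integrates the lengths of the vertical sections, and the shear merely translates the
    section over [x], by an amount depending on [x]. *)
Lemma area_preserving_shear (c : R -> R) : measurable_fun setT c ->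
  area_preserving (fun p => (p.1, p.2 + c p.1)).
Proof.
move=> mc; split.
  apply: measurable_fun_pair; first exact: measurable_fst.
  by apply: measurable_funD => //; exact: measurableT_comp.
move=> B mB; apply: eq_integral => x _ /=.
rewrite -[RHS](lebesgue_measure_shift (c x)); last exact: measurable_xsection.
by congr (mu _); apply/seteqP; split => y; rewrite /xsection/= !inE.
Qed.

Lemma area_preserving_swap : area_preserving (fun p => (p.2, p.1)).
Proof.
split; first exact: measurable_swap.
move=> B mB; rewrite /area.
(* By conversion the left side is the product measure integrated in the other order; the two
   products agree on rectangles, hence everywhere. *)
transitivity ((mu \x^ mu)%E B) => //.
by apply/esym/product_measure_unique => // A1 A2 m1 m2; exact: product_measure2E.
Qed.

Lemma area_preserving_hshear (c : R -> R) : measurable_fun setT c ->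
  area_preserving (fun p => (p.1 + c p.2, p.2)).
Proof.
move=> mc; have := area_preserving_comp _ _ area_preserving_swap
  (area_preserving_comp _ _ (area_preserving_shear _ mc) area_preserving_swap).
by [].
Qed.

Lemma area_preserving_translation (c : R * R) :
  area_preserving (fun p => p - c).
Proof.
have := area_preserving_comp _ _
  (area_preserving_hshear (cst (- c.1)) (measurable_cst _))
  (area_preserving_shear (cst (- c.2)) (measurable_cst _)).
by [].
Qed.

(** For [a = cos t] and [b = sin t] the three shears have coefficients [- tan (t / 2)], [sin t] and
    [- tan (t / 2)]. Only the half turn escapes this, and it is a quarter turn done twice. *)
Lemma area_preserving_rotation (a b : R) : a ^+ 2 + b ^+ 2 = 1 ->
  area_preserving (fun p => (a * p.1 - b * p.2, b * p.1 + a * p.2)).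
Proof.
have half (a' b' : R) : a' != -1 -> a' ^+ 2 + b' ^+ 2 = 1 ->
    area_preserving (fun p => (a' * p.1 - b' * p.2, b' * p.1 + a' * p.2)).
  move=> aN1 ab1; set k := - b' / (1 + a').
  have a1 : 1 + a' != 0 by rewrite addrC -subr_eq0 opprK in aN1 *.
  have kE : k * (1 + a') = - b' by rewrite /k divfK.
  have kE' : k * a' = - b' - k by rewrite -kE mulrDr mulr1 addrC addKr.
  have kb : k * b' = a' - 1.
    by apply: (mulIf a1); rewrite mulrAC kE; move: ab1; lra.
  have mM (c : R) : measurable_fun setT (fun x => c * x) by exact: measurable_funM.
  have [mT aT] := area_preserving_comp _ _ (area_preserving_hshear _ (mM k))
    (area_preserving_comp _ _ (area_preserving_shear _ (mM b'))
       (area_preserving_hshear _ (mM k))).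
  have <- : (fun p : R * R => (p.1 + k * p.2, p.2)) \o
    ((fun p => (p.1, p.2 + b' * p.1)) \o (fun p => (p.1 + k * p.2, p.2))) =
    (fun p => (a' * p.1 - b' * p.2, b' * p.1 + a' * p.2)).
    apply/funext => -[x y] /=; congr pair; last by ring: kb.
    transitivity (x + (k * b') * x + (k + k + k * (k * b')) * y); first by ring.
    by rewrite kb; ring: kE'.
  by split.
move=> ab1; have [aN1|] := eqVneq a (-1); last by move/half; exact.
have b0 : b = 0.
  by apply/eqP; rewrite -sqrf_eq0; apply/eqP; move: ab1; rewrite aN1; lra.
have [mT aT] : area_preserving (fun p => (0 * p.1 - 1 * p.2, 1 * p.1 + 0 * p.2)).
  by apply: half; [rewrite eq_sym oppr_eq0 oner_eq0|ring].
have := area_preserving_comp _ _ (conj mT aT) (conj mT aT).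
congr area_preserving; apply/funext => -[x y] /=.
by rewrite aN1 b0; congr pair; ring.
Qed.

(** The midpoint [m] is moved to the origin, then the unit vector [(u, v)] pointing from [xd] to
    [xs] is rotated onto the second axis. Both maps are isometries, so they carry [shat] along. *)
Lemma area_shat_le_std (d g : R) (xs xd : R * R) : 0 < d ->
  enorm (xs - xd) = 2 * d ->
  measurable [set p : R * R | shat (0, d) (0, - d) p <= g] ->
  area [set p | shat xs xd p <= g] =
  area [set p | shat (0, d) (0, - d) p <= g].
Proof.
move=> d0 dE mL; set u := (xs.1 - xd.1) / (2 * d); set v := (xs.2 - xd.2) / (2 * d).
have uE : 2 * d * u = xs.1 - xd.1 by rewrite mulrC divfK// lt0r_neq0// mulr_gt0.
have vE : 2 * d * v = xs.2 - xd.2 by rewrite mulrC divfK// lt0r_neq0// mulr_gt0.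
have vu1 : v ^+ 2 + u ^+ 2 = 1.
  have : (2 * d) ^+ 2 != 0 by rewrite sqrf_eq0 lt0r_neq0// mulr_gt0.
  move/mulfI; apply; rewrite mulr1 -[in RHS]dE /enorm sqr_sqrtr ?addr_ge0 ?sqr_ge0//=.
  by rewrite -uE -vE; ring.
have vE2 : v ^+ 2 = 1 - u ^+ 2 by rewrite -vu1 addrK.
pose m : R * R := ((xs.1 + xd.1) / 2, (xs.2 + xd.2) / 2).
have [_ aT] := area_preserving_comp _ _ (area_preserving_rotation _ _ vu1)
  (area_preserving_translation m).
rewrite -[RHS](aT _ mL); congr area; apply/seteqP.
suff E p : shat xs xd p = shat (0, d) (0, - d)
    (v * (p - m).1 - u * (p - m).2, u * (p - m).1 + v * (p - m).2).
  by split => p; rewrite /= E.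
rewrite /shat /enorm; congr (Num.max (Num.sqrt _) (Num.sqrt _)) => /=.
  (* The source is [m + d (u, v)] and the destination is [m - d (u, v)]. *)
  have -> : xs.1 - p.1 = d * u - (p.1 - (xs.1 + xd.1) / 2) by lra.
  have -> : xs.2 - p.2 = d * v - (p.2 - (xs.2 + xd.2) / 2) by lra.
  move: (_ - _ / 2) (_ - _ / 2) => q1 q2; ring: vE2.
have -> : p.1 - xd.1 = d * u + (p.1 - (xs.1 + xd.1) / 2) by lra.
have -> : p.2 - xd.2 = d * v + (p.2 - (xs.2 + xd.2) / 2) by lra.
move: (_ - _ / 2) (_ - _ / 2) => q1 q2; ring: vE2.
Qed.

End AreaPreserving.

(** * The lens and its area *)

Section Lens.
Context {R : realType}.
Local Notation mu := (@lebesgue_measure R).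
Implicit Types (d g x : R) (p xs xd : R * R).

Lemma enorm_ge0 p : 0 <= enorm p.
Proof. exact: sqrtr_ge0. Qed.

Lemma enorm_le p g : 0 <= g -> (enorm p <= g) = (p.1 ^+ 2 + p.2 ^+ 2 <= g ^+ 2).
Proof.
by move=> g0; rewrite -[in LHS](ger0_norm g0) -sqrtr_sqr ler_sqrt// sqr_ge0.
Qed.

Lemma measurable_fun_enorm disp (T : measurableType disp) (f : T -> R * R) :
  measurable_fun setT f -> measurable_fun setT (enorm \o f).
Proof.
move=> mf; apply: (measurableT_comp (continuous_measurable_fun (@sqrt_continuous R))).
apply: measurable_funD; apply: measurable_funX.
  exact: measurableT_comp.
exact: measurableT_comp.
Qed.

Lemma measurable_shat_le xs xd g : measurable [set p | shat xs xd p <= g].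
Proof.
have mB (a b : R * R -> R * R) : measurable_fun setT a -> measurable_fun setT b ->
   measurable_fun setT (fun p => a p - b p).
  move=> ma mb; apply: measurable_fun_pair; apply: measurable_funB;
    exact: measurableT_comp.
have m1 := measurable_fun_enorm _ _ _
  (mB _ _ (measurable_cst xs) (@measurable_id _ _ setT)).
have m2 := measurable_fun_enorm _ _ _
  (mB _ _ (@measurable_id _ _ setT) (measurable_cst xd)).
have -> : [set p | shat xs xd p <= g] =
  (fun p => enorm (xs - p)) @^-1` `]-oo, g] `&`
  (fun p => enorm (p - xd)) @^-1` `]-oo, g].
  by apply/seteqP; split => p; rewrite /= !in_itv/= /shat ge_max => /andP.
by apply: measurableI; rewrite -[X in measurable X]setTI; [exact: m1|exact: m2].
Qed.

Lemma norm_le_enorm p : `|p| <= enorm p.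
Proof.
rewrite prod_normE/= ge_max -!sqrtr_sqr !ler_sqrt ?addr_ge0 ?sqr_ge0//.
by rewrite lerDl lerDr !sqr_ge0.
Qed.

(** The disc around [xd] is already bounded; [norm_le_enorm] passes to the sup norm, in which
    boundedness is stated. *)
Lemma bounded_shat_le xs xd g : bounded_set [set p | shat xs xd p <= g].
Proof.
exists (`|xd| + g); split; first exact: num_real.
move=> M gM p /=; rewrite /shat ge_max => /andP[_ pg].
rewrite -(subrK xd p) addrC (le_trans (ler_normD _ _))// (le_trans _ (ltW gM))//.
by rewrite lerD2l (le_trans _ pg)// norm_le_enorm.
Qed.

Lemma shat_ge0 xs xd p : 0 <= shat xs xd p.
Proof. by rewrite /shat le_max enorm_ge0. Qed.

Lemma shat_le_sqr xs xd p g : 0 <= g -> (shat xs xd p <= g) =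
  ((xs.1 - p.1) ^+ 2 + (xs.2 - p.2) ^+ 2 <= g ^+ 2) &&
  ((p.1 - xd.1) ^+ 2 + (p.2 - xd.2) ^+ 2 <= g ^+ 2).
Proof. by move=> g0; rewrite /shat ge_max !enorm_le. Qed.

(** By the parallelogram law the squared lengths of [xs - p] and [p - xd] add up to at least half of
    [(2 * d) ^+ 2], so the longer one has length at least [d]. *)
Lemma shat_ge xs xd d p : 0 < d -> enorm (xs - xd) = 2 * d -> d <= shat xs xd p.
Proof.
move=> d0 dE; have s0 := shat_ge0 xs xd p.
have := lexx (shat xs xd p); rewrite {1}shat_le_sqr//.
have : (xs.1 - xd.1) ^+ 2 + (xs.2 - xd.2) ^+ 2 = (2 * d) ^+ 2.
  by rewrite -dE sqr_sqrtr// addr_ge0 ?sqr_ge0.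
move: (shat _ _ _) s0 => s s0 dsq /andP[h1 h2].
rewrite -ler_sqr ?nnegrE ?(ltW d0)//.
have := sqr_ge0 ((xs.1 - p.1) - (p.1 - xd.1)).
have := sqr_ge0 ((xs.2 - p.2) - (p.2 - xd.2)).
move: dsq h1 h2; rewrite !expr2; lra.
Qed.

(** This describes the lens by its vertical sections. The centre farther from [p] gives the binding
    condition, in which [p.2] enters through [|p.2| + d]. *)
Lemma shat_std_le d g p : 0 < d <= g ->
  (shat (0, d) (0, - d) p <= g) =
  (`|p.1| <= Num.sqrt (g ^+ 2 - d ^+ 2)) &&
  (`|p.2| <= Num.sqrt (g ^+ 2 - p.1 ^+ 2) - d).
Proof.
case: p => x y /andP[d0 dg]; rewrite shat_le_sqr/=; last by lra.
have g2 : d ^+ 2 <= g ^+ 2 by rewrite ler_sqr ?nnegrE; lra.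
rewrite -sqrtr_sqr ler_sqrt ?subr_ge0//.
rewrite !lerBrDr.
(* If this bound fails, so do both sides: averaging the two disc conditions gives
   [x ^+ 2 + y ^+ 2 + d ^+ 2 <= g ^+ 2]. *)
have [xg|xg] := leP (x ^+ 2 + d ^+ 2) (g ^+ 2); last first.
  apply/negP => /andP[h1 h2]; move: h1 h2 xg.
  have := sqr_ge0 y; have := sqr_ge0 x; rewrite !expr2; lra.
have yd : 0 <= `|y| + d by rewrite addr_ge0// ltW.
rewrite -[X in _ = (X <= _)](ger0_norm yd) -sqrtr_sqr ler_sqrt; last first.
  by have := sqr_ge0 d; lra.
rewrite [X in _ = (X <= _)]sqrrD real_normK ?num_real//.
have [y0|y0] := ger0P y; apply/andP/idP.
- by move=> [_]; rewrite !expr2; lra.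
- by rewrite !expr2 => h; split; nra.
- by move=> [+ _]; rewrite !expr2; lra.
- by rewrite !expr2 => h; split; nra.
Qed.

(** The first two terms are the classical antiderivative of twice the half-circle function. The
    strict bound makes the root and [asin] differentiable. *)
Lemma is_derive_circle_antiderivative d g x : `|x| < g ->
  is_derive x 1 (fun t => t * Num.sqrt (g ^+ 2 - t ^+ 2) + g ^+ 2 * asin (t / g)
                          - 2 * d * t)
    (2 * (Num.sqrt (g ^+ 2 - x ^+ 2) - d)).
Proof.
move=> xg; have g0 : 0 < g by rewrite (le_lt_trans _ xg).
have x2g : 0 < g ^+ 2 - x ^+ 2.
  by rewrite subr_gt0 -(real_normK (num_real x)) ltr_sqr ?nnegrE// ltW.
have xg1 : -1 < x / g < 1.
  by rewrite -ltr_norml normrM (gtr0_norm (x := g^-1)) ?invr_gt0// ltr_pdivrMr// mul1r.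
have sE : Num.sqrt (1 - (x / g) ^+ 2) = Num.sqrt (g ^+ 2 - x ^+ 2) / g.
  have -> : 1 - (x / g) ^+ 2 = (g ^+ 2 - x ^+ 2) * g^-1 ^+ 2.
    by field; rewrite gt_eqF.
  by rewrite sqrtrM ?(ltW x2g)// sqrtr_sqr gtr0_norm// invr_gt0.
have dsq := is_derive1_sqrt x2g.
have das := is_derive1_asin xg1.
have d1 : is_derive x 1 (fun t => Num.sqrt (g ^+ 2 - t ^+ 2))
   (- (x / Num.sqrt (g ^+ 2 - x ^+ 2))).
  have di : is_derive x 1 (fun t => g ^+ 2 - t ^+ 2) (- (2 * x)).
    by apply: is_derive_eq; rewrite /GRing.scale/=; ring.
  refine (is_derive_eq (@is_derive1_comp _ _ (fun t => g ^+ 2 - t ^+ 2) _ _ _ dsq di) _).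
  by field; rewrite gt_eqF// sqrtr_gt0.
have d2 : is_derive x 1 (fun t => asin (t / g)) (Num.sqrt (g ^+ 2 - x ^+ 2))^-1.
  have di : is_derive x 1 (fun t => t / g) g^-1.
    by apply: is_derive_eq; rewrite /GRing.scale/=; ring.
  refine (is_derive_eq (@is_derive1_comp _ _ (fun t => t / g) _ _ _ das di) _).
  by rewrite sE; field; rewrite !gt_eqF// sqrtr_gt0.
apply: is_derive_eq; rewrite /GRing.scale/=.
have s0 : Num.sqrt (g ^+ 2 - x ^+ 2) != 0 by rewrite gt_eqF// sqrtr_gt0.
(* Multiplying by the root [s] leaves a polynomial identity modulo [s ^+ 2 = g ^+ 2 - x ^+ 2]. *)
apply: (mulIf s0); have := sqr_sqrtr (ltW x2g).
move: (Num.sqrt _) s0 => s s0 s2.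
rewrite [LHS](_ : _ = - x ^+ 2 + s ^+ 2 + g ^+ 2 - 2 * d * s); last by field.
have -> : 2 * (s - d) * s = 2 * s ^+ 2 - 2 * d * s by ring.
by rewrite s2; ring.
Qed.

Lemma asinN x : -1 <= x <= 1 -> asin (- x) = - asin x.
Proof.
move=> x1; rewrite -{1}[x]asinK ?in_itv//= -sinN sinK// in_itv/=.
by rewrite lerN2 lerNl asin_lepi2//= asin_geNpi2.
Qed.

Lemma integral_lens_width d g : 0 < d -> d <= g ->
  (\int[mu]_(x in `[(- Num.sqrt (g ^+ 2 - d ^+ 2))%R, (Num.sqrt (g ^+ 2 - d ^+ 2))%R])
     (2 * (Num.sqrt (g ^+ 2 - x ^+ 2) - d))%:E =
   (2 * (g ^+ 2 * asin (Num.sqrt (g ^+ 2 - d ^+ 2) / g)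
         - d * Num.sqrt (g ^+ 2 - d ^+ 2)))%:E)%E.
Proof.
(* For [g = d] the interval is a point; the fundamental theorem of calculus asks for distinct
   endpoints. *)
move=> d0; rewrite le_eqVlt => /predU1P[<-|dg].
  rewrite subrr sqrtr0 oppr0 set_itv1 integral_set1 mul0r -[X in asin X]sin0 sinK.
    by rewrite !mulr0 subrr mulr0.
  by rewrite in_itv/= oppr_le0 divr_ge0 ?pi_ge0.
have g0 : 0 < g by lra.
set h := Num.sqrt _.
have h2 : h ^+ 2 = g ^+ 2 - d ^+ 2.
  by rewrite sqr_sqrtr// subr_ge0 ler_sqr ?nnegrE ?ltW// (lt_trans d0).
have h0 : 0 < h by rewrite sqrtr_gt0 subr_gt0 ltr_sqr ?nnegrE ?ltW// (lt_trans d0).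
(* As [d > 0], the endpoints stay strictly inside the disc of radius [g], so [F] is differentiable
   at them too. *)
have hg : h < g.
  by rewrite -ltr_sqr ?nnegrE ?(ltW h0) ?(ltW g0)// h2 ltrBlDr ltrDl exprn_gt0.
pose F (t : R) : R :=
  t * Num.sqrt (g ^+ 2 - t ^+ 2) + g ^+ 2 * asin (t / g) - 2 * d * t.
have dF x : x \in `[- h, h] -> is_derive x 1 F
    (2 * (Num.sqrt (g ^+ 2 - x ^+ 2) - d)).
  rewrite in_itv/= -ler_norml => xh.
  exact/is_derive_circle_antiderivative/(le_lt_trans xh).
have hN : - h \in `[- h, h] by rewrite in_itv/= lexx; lra.
have hP : h \in `[- h, h] by rewrite in_itv/= lexx; lra.
have cF x : x \in `[- h, h] -> {for x, continuous F}.
  move=> xh; have dFx := dF _ xh.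
  by apply: differentiable_continuous; apply/derivable1_diffP; exact: ex_derive.
have cf : continuous (fun x : R => 2 * (Num.sqrt (g ^+ 2 - x ^+ 2) - d)).
  move=> x; apply: cvgMr; apply: cvgB; last exact: cvg_cst.
  apply: continuous_comp; last exact: sqrt_continuous.
  by apply: cvgB; [exact: cvg_cst|exact: exprn_continuous].
rewrite (@continuous_FTC2 _ _ F).
- rewrite -EFinB /F; congr EFin.
  have sd : Num.sqrt (g ^+ 2 - h ^+ 2) = d.
    by rewrite h2 opprB addrC subrK sqrtr_sqr gtr0_norm.
  rewrite sqrrN sd (mulNr h g^-1) asinN; first ring.
  have hg0 : 0 <= h / g by rewrite divr_ge0 ?ltW.
  by rewrite ler_pdivrMr// mul1r (ltW hg) andbT (le_trans _ hg0)// oppr_le0.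
- by lra.
- exact: continuous_subspaceT.
- split.
  + move=> x xh; have dFx := dF _ (subset_itv_oo_cc xh); exact: ex_derive.
  + exact/cvg_at_right_filter/cF.
  + exact/cvg_at_left_filter/cF.
- move=> x xh; have dFx := dF _ (subset_itv_oo_cc xh).
  by rewrite derive1E derive_val.
Qed.

Lemma sqrt_ratio d g : 0 < d ->
  Num.sqrt ((g / d) ^+ 2 - 1) = Num.sqrt (g ^+ 2 - d ^+ 2) / d.
Proof.
move=> d0; have -> : (g / d) ^+ 2 - 1 = (g ^+ 2 - d ^+ 2) * d^-1 ^+ 2.
  by field; rewrite gt_eqF.
by rewrite mulrC sqrtrM ?sqr_ge0// sqrtr_sqr gtr0_norm ?invr_gt0// mulrC.
Qed.

Lemma acos_lt_pihalf x : 0 < x <= 1 -> acos x < pi / 2.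
Proof.
move=> /andP[x0 x1]; have x11 : -1 <= x <= 1 by rewrite x1 andbT; lra.
have o11 : -1 <= (0 : R) <= 1 by rewrite lerN10 ler01.
by rewrite -acos0 -ltr_cos ?in_itv/= ?acos_ge0 ?acos_lepi// !acosK ?in_itv.
Qed.

(** Both sides are the angle between the leg [d] and the hypotenuse [g] of a right triangle. It lies
    below [pi / 2], where [asin] inverts the sine. *)
Lemma arcsec_asin d g : 0 < d -> d <= g ->
  arcsec (g / d) = asin (Num.sqrt (g ^+ 2 - d ^+ 2) / g).
Proof.
move=> d0 dg; have g0 : 0 < g by lra.
have dg0 : 0 < d / g by rewrite divr_gt0.
have dg1 : -1 <= d / g <= 1.
  by rewrite ler_pdivrMr// mul1r dg andbT; lra.
rewrite /arcsec invf_div -[LHS]sinK ?sin_acos//.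
  congr asin; have -> : 1 - (d / g) ^+ 2 = g^-1 ^+ 2 * (g ^+ 2 - d ^+ 2).
    by field; rewrite gt_eqF.
  by rewrite sqrtrM ?sqr_ge0// sqrtr_sqr gtr0_norm ?invr_gt0// mulrC.
rewrite in_itv/= (le_trans _ (acos_ge0 dg1)) ?oppr_le0 ?divr_ge0 ?pi_ge0//=.
by rewrite ltW// acos_lt_pihalf// dg0 ler_pdivrMr// mul1r.
Qed.

Definition lens_area d g : R :=
  2 * d ^+ 2 * ((g / d) ^+ 2 * arcsec (g / d) - Num.sqrt ((g / d) ^+ 2 - 1)).

Lemma area_lens_std d g : 0 < d -> d <= g ->
  area [set p | shat (0, d) (0, - d) p <= g] = (lens_area d g)%:E.
Proof.
move=> d0 dg; rewrite /lens_area arcsec_asin// sqrt_ratio//; set h := Num.sqrt _.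
transitivity (\int[mu]_(x in `[(- h)%R, h])
    (2 * (Num.sqrt (g ^+ 2 - x ^+ 2) - d))%:E)%E.
  (* Extending the integrand by zero matches the empty sections outside [[- h, h]]. *)
  rewrite [RHS]integral_mkcond; apply: eq_integral => x _ /=.
  rewrite patchE; case: ifPn => [|/negP]; rewrite inE/= in_itv/= -ler_norml => xh.
    have sd : d <= Num.sqrt (g ^+ 2 - x ^+ 2).
      rewrite -[leLHS]gtr0_norm// -sqrtr_sqr ler_wsqrtr// lerBrDr addrC -lerBrDr.
      rewrite -[leRHS]sqr_sqrtr; last by rewrite subr_ge0 ler_sqr ?nnegrE; lra.
      by rewrite -(real_normK (num_real x)) ler_sqr ?nnegrE// sqrtr_ge0.
    rewrite (_ : xsection _ _ = `[- (Num.sqrt (g ^+ 2 - x ^+ 2) - d),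
                              Num.sqrt (g ^+ 2 - x ^+ 2) - d]%classic).
      rewrite lebesgue_measure_itv/= lte_fin; case: ifPn => sd0.
        by rewrite -EFinB; congr EFin; lra.
      (* The endpoints are not strictly ordered here, and with [sd] this forces the width to be
         0. *)
      by congr EFin; move: sd0; rewrite -leNgt; lra.
    apply/seteqP; split => y; rewrite /xsection/= inE/= shat_std_le ?d0//= xh/=.
      by rewrite ler_norml in_itv.
    by rewrite ler_norml in_itv.
  rewrite (_ : xsection _ _ = set0) ?measure0//.
  apply/seteqP; split => // y; rewrite /xsection/= inE/= shat_std_le ?d0//=.
  by case/andP.
rewrite integral_lens_width//; congr EFin; rewrite -/h.
by field; rewrite gt_eqF.
Qed.

Lemma area_lens d g (xs xd : R * R) : 0 < d -> enorm (xs - xd) = 2 * d ->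
  d <= g -> area [set p | shat xs xd p <= g] = (lens_area d g)%:E.
Proof.
move=> d0 dE dg; rewrite (area_shat_le_std d) ?area_lens_std//.
exact: measurable_shat_le.
Qed.

Lemma arcsec_atan (u : R) : 1 <= u -> arcsec u = atan (Num.sqrt (u ^+ 2 - 1)).
Proof.
move=> u1; have u0 : 0 < u by lra.
have v1 : -1 <= u^-1 <= 1.
  have := invr_gt0 u; rewrite u0 => v0.
  by rewrite invf_le1// u1 andbT; lra.
rewrite /arcsec -[LHS]tanK.
  congr atan; rewrite /tan sin_acos// acosK ?in_itv//= invrK.
  have -> : u ^+ 2 - 1 = u ^+ 2 * (1 - u^-1 ^+ 2) by field; rewrite gt_eqF.
  by rewrite sqrtrM ?sqr_ge0// sqrtr_sqr gtr0_norm// mulrC.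
rewrite in_itv/= (lt_le_trans _ (acos_ge0 v1)) ?oppr_lt0 ?divr_gt0 ?pi_gt0//=.
by rewrite acos_lt_pihalf// invr_gt0 u0 invf_le1.
Qed.

End Lens.

(** * The density *)

Section Density.
Context {R : realType}.
Local Notation mu := (@lebesgue_measure R).
Implicit Types (lambda d g x : R).

(* [acos] is only known to be continuous on the open interval, [atan] is
   continuous everywhere; hence this variant, equal to [lens_area d] on [d, +oo[. *)
Definition lens_area_atan d g : R :=
  2 * d ^+ 2 * ((g / d) ^+ 2 * atan (Num.sqrt ((g / d) ^+ 2 - 1))
                - Num.sqrt ((g / d) ^+ 2 - 1)).

Lemma lens_area_atanE d g : 0 < d -> d <= g -> lens_area d g = lens_area_atan d g.
Proof.
by move=> d0 dg; rewrite /lens_area arcsec_atan// ler_pdivlMr// mul1r.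
Qed.

Lemma lens_areaxx d : 0 < d -> lens_area d d = 0.
Proof.
move=> d0; rewrite /lens_area divff ?gt_eqF// /arcsec invr1 acos1.
by rewrite expr1n subrr sqrtr0 mulr0 subr0 mulr0.
Qed.

(** Growing both radii moves the boundary outwards at unit speed, so the derivative is the perimeter
    of the lens: two arcs of angle [2 * arcsec (g / d)]. In the computation, the derivatives of
    [atan] and of the outer root cancel. *)
Lemma is_derive_lens_area_atan d g : 0 < d -> d < g ->
  is_derive g 1 (lens_area_atan d)
    (4 * g * atan (Num.sqrt ((g / d) ^+ 2 - 1))).
Proof.
move=> d0 dg; have u1 : 1 < g / d by rewrite ltr_pdivlMr// mul1r.
have u2 : 0 < (g / d) ^+ 2 - 1 by rewrite subr_gt0 expr_gt1// ltW// (lt_trans _ u1).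
have di : is_derive g 1 (fun t => (t / d) ^+ 2 - 1) (2 * (g / d) / d).
  by apply: is_derive_eq; rewrite /GRing.scale/=; ring.
have ds : is_derive g 1 (fun t => Num.sqrt ((t / d) ^+ 2 - 1))
    (g / d / d / Num.sqrt ((g / d) ^+ 2 - 1)).
  refine (is_derive_eq (@is_derive1_comp _ _ (fun t => (t / d) ^+ 2 - 1) _ _ _
    (is_derive1_sqrt u2) di) _).
  by field; rewrite !gt_eqF// sqrtr_gt0.
have da : is_derive g 1 (fun t => atan (Num.sqrt ((t / d) ^+ 2 - 1)))
    (g * Num.sqrt ((g / d) ^+ 2 - 1))^-1.
  refine (is_derive_eq (@is_derive1_comp _ _ (fun t => Num.sqrt ((t / d) ^+ 2 - 1)) _ _ _
    (is_derive1_atan _) ds) _).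
  rewrite sqr_sqrtr ?ltW// addrC subrK.
  field; rewrite ?gt_eqF ?sqrtr_gt0//; lra.
apply: is_derive_eq; rewrite /GRing.scale/=.
have : Num.sqrt ((g / d) ^+ 2 - 1) != 0 by rewrite gt_eqF// sqrtr_gt0.
move: (Num.sqrt _) => s s0.
by field; rewrite s0 !gt_eqF// (lt_trans d0).
Qed.

Lemma continuous_sqrt_ratio d : continuous (fun t : R => Num.sqrt ((t / d) ^+ 2 - 1)).
Proof.
move=> x; apply: continuous_comp; last exact: sqrt_continuous.
apply: cvgB; last exact: cvg_cst.
apply: (@continuous_comp _ _ _ (fun t : R => t / d) (fun t : R => t ^+ 2)).
  by apply: cvgMl; exact: cvg_id.
exact: exprn_continuous.
Qed.

Lemma continuous_atan_sqrt_ratio d :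
  continuous (fun t : R => atan (Num.sqrt ((t / d) ^+ 2 - 1))).
Proof.
move=> x.
apply: (@continuous_comp _ _ _ (fun t : R => Num.sqrt ((t / d) ^+ 2 - 1)) atan).
  exact: continuous_sqrt_ratio.
exact: continuous_atan.
Qed.

Lemma continuous_lens_area_atan d : continuous (lens_area_atan d).
Proof.
move=> x; apply: cvgMr; apply: cvgB; last exact: continuous_sqrt_ratio.
apply: cvgM; last exact: continuous_atan_sqrt_ratio.
apply: (@continuous_comp _ _ _ (fun t : R => t / d) (fun t : R => t ^+ 2)).
  by apply: cvgMl; exact: cvg_id.
exact: exprn_continuous.
Qed.

Lemma continuous_expR_lens_area lambda d :
  continuous (fun t => expR (- (lambda * lens_area_atan d t))).
Proof.
move=> x.
apply: (@continuous_comp _ _ _ (fun t : R => - (lambda * lens_area_atan d t)) expR).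
  by apply: cvgN; apply: cvgMr; exact: continuous_lens_area_atan.
exact: continuous_expR.
Qed.

Definition relay_pdf lambda d g : R :=
  4 * lambda * g * arcsec (g / d) * expR (- (lambda * lens_area d g)).

Definition relay_pdf_atan lambda d g : R :=
  4 * lambda * g * atan (Num.sqrt ((g / d) ^+ 2 - 1))
  * expR (- (lambda * lens_area_atan d g)).

Lemma continuous_relay_pdf_atan lambda d : continuous (relay_pdf_atan lambda d).
Proof.
move=> x; apply: cvgM; last exact: continuous_expR_lens_area.
apply: cvgM; last exact: continuous_atan_sqrt_ratio.
by apply: cvgMr; exact: cvg_id.
Qed.

Lemma relay_pdf_atanE lambda d g : 0 < d -> d <= g ->
  relay_pdf lambda d g = relay_pdf_atan lambda d g.
Proof.
move=> d0 dg; rewrite /relay_pdf lens_area_atanE// arcsec_atan//.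
by rewrite ler_pdivlMr// mul1r.
Qed.

(** On [[d, g]] the integrand has the antiderivative [- expR (- (lambda * lens_area_atan d t))],
    whose value at [d] is -1 because the lens degenerates there. *)
Lemma integral_relay_pdf_cc lambda d g : 0 < d -> d <= g ->
  (\int[mu]_(x in `[d, g]) (relay_pdf lambda d x)%:E =
   (1 - expR (- (lambda * lens_area d g)))%:E)%E.
Proof.
move=> d0 dg.
under eq_integral.
  move=> x; rewrite inE/= in_itv/= => /andP[dx _].
  rewrite relay_pdf_atanE//; over.
have [->|gd] := eqVneq g d.
  by rewrite set_itv1 integral_set1 lens_areaxx// mulr0 oppr0 expR0 subrr.
have cF : continuous (fun t => - expR (- (lambda * lens_area_atan d t))).
  by move=> x; apply: cvgN; exact: continuous_expR_lens_area.
have dF x : d < x -> is_derive x 1 (fun t => - expR (- (lambda * lens_area_atan d t)))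
    (relay_pdf_atan lambda d x).
  move=> dx; have dA := is_derive_lens_area_atan d x d0 dx.
  have dL : is_derive x 1 (fun t => - (lambda * lens_area_atan d t))
    (- (lambda * (4 * x * atan (Num.sqrt ((x / d) ^+ 2 - 1))))).
    exact: is_derive_eq.
  have dE := @is_derive1_comp _ _ (fun t => - (lambda * lens_area_atan d t)) _ _ _
    (is_derive_expR _) dL.
  refine (is_derive_eq (is_deriveN dE) _).
  by rewrite /relay_pdf_atan; ring.
rewrite (@continuous_FTC2 _ _ (fun t => - expR (- (lambda * lens_area_atan d t)))).
- by rewrite -!lens_area_atanE// lens_areaxx// mulr0 oppr0 expR0 -EFinB opprK addrC.
- by rewrite lt_neqAle eq_sym gd.
- exact/continuous_subspaceT/continuous_relay_pdf_atan.
(* Differentiability is required only in the open interval; at [d], where the root vanishes,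
   continuity is enough. *)
- split.
  + by move=> x /[!in_itv]/= /andP[/dF dx _]; exact: ex_derive.
  + exact/cvg_at_right_filter/cF.
  + exact/cvg_at_left_filter/cF.
- move=> x /[!in_itv]/= /andP[/dF dx _].
  by rewrite derive1E derive_val.
Qed.

Definition relay_density lambda d (g : R) : R :=
  relay_pdf lambda d g * \1_[set u : R | d <= u] g.

Lemma relay_densityE lambda d : relay_density lambda d = (relay_pdf lambda d) \_ `[d, +oo[.
Proof.
apply/funext => g; rewrite /relay_density patchE indicE.
have -> : (g \in `[d, +oo[%classic) = (g \in [set u : R | d <= u]).
  by apply/idP/idP; rewrite !inE/= in_itv/= andbT.
by case: (g \in _); rewrite ?mulr1 ?mulr0.
Qed.

Lemma measurable_relay_density lambda d : 0 < d ->
  measurable_fun setT (relay_density lambda d).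
Proof.
move=> d0; rewrite relay_densityE; apply/measurable_restrict => //.
apply: (eq_measurable_fun (relay_pdf_atan lambda d)).
  by move=> x; rewrite inE/= in_itv/= andbT => -[_ dx]; rewrite relay_pdf_atanE.
apply: measurable_funTS; apply: continuous_measurable_fun.
exact: continuous_relay_pdf_atan.
Qed.

Lemma relay_density_ge0 lambda d g : 0 < lambda -> 0 < d -> 0 <= relay_density lambda d g.
Proof.
move=> l0 d0; rewrite relay_densityE patchE; case: ifPn => // /[!inE]/=.
rewrite in_itv/= andbT => dg; rewrite relay_pdf_atanE//.
have g0 : 0 < g by lra.
apply/mulr_ge0/expR_ge0; apply: mulr_ge0; first by rewrite !mulr_ge0// ltW.
by rewrite -[leLHS]atan0; exact/le_atan/sqrtr_ge0.
Qed.

Lemma integral_relay_density lambda d x : 0 < lambda -> 0 < d ->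
  (\int[mu]_(y in `]-oo, x]) (relay_density lambda d y)%:E =
  (if x < d then 0 else 1 - expR (- (lambda * lens_area d x)))%:E)%E.
Proof.
move=> l0 d0; transitivity (\int[mu]_(y in `]-oo, x])
    ((EFin \o relay_pdf lambda d) \_ `[d, +oo[) y)%E.
  by apply: eq_integral => y _; rewrite relay_densityE !patchE; case: ifP.
rewrite -integral_mkcondr; case: ifPn => xd.
  rewrite (_ : _ `&` _ = set0) ?integral_set0//.
  apply/seteqP; split => // y [] /=; rewrite !in_itv/= andbT; lra.
rewrite (_ : _ `&` _ = `[d, x]%classic) ?integral_relay_pdf_cc// ?leNgt//.
apply/seteqP; split => y /=; rewrite !in_itv/= andbT .
  by move=> [-> ->].
by move=> /andP[-> ->].
Qed.

(** * From distribution functions to densities *)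

Definition rays : set (set R) := [set A | exists x : R, A = `]-oo, x]%classic].

(** Half-open intervals generate the Borel sets, and each is a difference of two rays. *)
Lemma measurable_rays : (@measurable _ R) = rays.-sigma.-measurable.
Proof.
have mray x : rays.-sigma.-measurable `]-oo, x]%classic.
  by apply: sub_sigma_algebra; exists x.
apply/seteqP; split => A.
  apply: smallest_sub; first exact: smallest_sigma_algebra.
  move=> _ [[a b] _ <-] /=.
  have -> : `]a, b]%classic = `]-oo, b] `\` `]-oo, a].
    apply/seteqP; split => x; rewrite /= !in_itv/=.
      by move=> /andP[ax ->]; split=> //; apply/negP; rewrite -ltNge.
    by move=> [-> /negP]; rewrite -ltNge => ->.
  exact: measurableD.
apply: smallest_sub; first exact: sigma_algebra_measurable.
by move=> _ [x ->]; exact: measurable_itv.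
Qed.

(** The law of [X] and the measure with density [f] agree on the rays, which are stable under
    intersection, generate the Borel sets and exhaust the line with finite mass. This determines a
    measure. *)
Lemma is_pdf_of_cdf disp (T : measurableType disp) (P : probability T R)
    (X : {RV P >-> R}) (f : R -> R) :
  measurable_fun [set: R] f -> (forall x, 0 <= f x) ->
  (forall x, cdf X x = \int[mu]_(y in `]-oo, x]) (f y)%:E)%E ->
  is_pdf X f.
Proof.
move=> mf f0 cdfE; split => // A mA.
pose nu := fun A : set R => (\int[mu]_(x in A) (f x)%:E)%E.
have nu0 : nu set0 = 0%E by exact: integral_set0.
have nu_ge0 B : (0 <= nu B)%E by apply: integral_ge0 => x _; rewrite lee_fin.
have mEf : measurable_fun setT (EFin \o f) by exact/measurable_EFinP.
have nuD : semi_sigma_additive nu.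
  exact: (@semi_sigma_additive_nng_induced _ (measurableTypeR R) R mu).
pose m := isMeasure.Build _ _ _ nu nu0 nu_ge0 nuD.
pose Nu : {measure set R -> \bar R} := HB.pack nu m.
apply: (@measure_unique _ _ _ rays (fun n => `]-oo, n%:R]%classic)
  measurable_rays _ _ _ (distribution P X) Nu) => //.
- move=> _ _ [x ->] [y ->]; exists (Num.min x y).
  by apply/seteqP; split => z; rewrite /= !in_itv/= le_min => /andP.
- by move=> n; exists n%:R.
- apply/seteqP; split => // x _; exists (Num.bound `|x|) => //=.
  by rewrite in_itv/= (le_trans (ler_norm x))// ltW// archi_boundP.
- by move=> _ [x ->]; exact: cdfE.
- by move=> n; rewrite -ge0_fin_numE ?fin_num_measure.
Qed.

End Density.

(** * The Poisson process *)

Section Minimum.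
Context {R : realType}.

Lemma exists_argmin {T : eqType} (f : T -> R) (A : set T) :
  finite_set A -> A !=set0 -> exists2 a, A a & forall b, A b -> f a <= f b.
Proof.
move=> /finite_seqP[s ->] {A} [a as_].
elim: s a as_ => // x s IH a _.
(* The induction hypothesis needs a point of the tail, so an empty tail is treated apart. *)
have [->|[y ys]] : s = [::] \/ exists y, y \in s.
- by case: s {IH} => [|y s]; [left|right; exists y; rewrite mem_head].
- exists x => [|b] /=; first by rewrite mem_head.
  by rewrite inE => /eqP ->.
have [c cs cmin] := IH y ys; have [xc|cx] := leP (f x) (f c).
- exists x => [|b] /=; first by rewrite mem_head.
  by rewrite inE => /predU1P[->//|/cmin]; exact: le_trans.
- exists c => [|b] /=; first by rewrite inE cs orbT.
  by rewrite inE => /predU1P[->|/cmin//]; exact: ltW.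
Qed.

Lemma counting_eq0 {T : choiceType} (A : set T) :
  (counting A = 0 :> \bar R) <-> A = set0.
Proof.
split=> [|->]; last first.
  by rewrite /counting asboolT// fset_set0.
rewrite /counting; case: ifPn => // /asboolP fA [] /eqP.
rewrite pnatr_eq0 finmap.cardfs_eq0 => /eqP A0.
by rewrite -(fset_setK fA) A0 set_fset0.
Qed.

(** Only relays at least as good as a fixed relay [a] compete; they lie in a bounded lens, so local
    finiteness leaves finitely many. *)
Lemma ex_shat_minimum xs xd (S : set (R * R)) : locally_finite S -> S !=set0 ->
  exists m, is_minimum (shat xs xd @` S) m.
Proof.
move=> lfS [a Sa].
pose L := [set p | shat xs xd p <= shat xs xd a].
have [||c [Sc ca] cmin] := @exists_argmin _ (shat xs xd) (S `&` L).
- exact/lfS/bounded_shat_le.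
- by exists a; split=> //; rewrite /L/=.
exists (shat xs xd c); split; first by exists c.
move=> _ [b Sb <-]; have [ba|/ltW ab] := leP (shat xs xd b) (shat xs xd a).
  exact: cmin.
exact: le_trans ab.
Qed.

(** The forward direction rests on attainment: an infimum would not give it at [g = m]. *)
Lemma shat_minimum_le xs xd (S : set (R * R)) m g :
  is_minimum (shat xs xd @` S) m ->
  (m <= g) <-> S `&` [set p | shat xs xd p <= g] !=set0.
Proof.
move=> [[a Sa am] lb]; split=> [mg|[b [Sb bg]]].
  by exists a; split => //=; rewrite am.
by apply: le_trans bg; apply: lb; exists b.
Qed.

End Minimum.

(** * Void probabilities and the law of the minimum *)

Section Poisson.
Context {R : realType} {disp : measure_display} {Omega : measurableType disp}.
Implicit Types (P : probability Omega R) (lambda : R) (Phi : Omega -> set (R * R)).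

Lemma bounded_borel_shat_le (xs xd : R * R) g :
  bounded_borel [set p | shat xs xd p <= g].
Proof. by split; [exact: measurable_shat_le|exact: bounded_shat_le]. Qed.

(** Adding the exceptional null set to both events makes them equal without changing their
    probabilities. *)
Lemma measure_eq_ae P (A B : set Omega) : measurable A -> measurable B ->
  {ae P, forall w, A w <-> B w} -> P A = P B.
Proof.
move=> mA mB [N [mN N0 sub]].
have E : A `|` N = B `|` N.
  apply/seteqP; split => w [h|]; try by right.
    have [|Nw] := pselect (N w); first by right.
    left; have [AB _] : A w <-> B w by apply: contrapT => /sub.
    exact: AB.
  have [|Nw] := pselect (N w); first by right.
  left; have [_ BA] : A w <-> B w by apply: contrapT => /sub.
  exact: BA.
by rewrite -(measureU0 mA mN N0) E measureU0.
Qed.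

Lemma measurable_void P lambda Phi B : homogeneous_poisson P lambda Phi ->
  bounded_borel B -> measurable [set w | Phi w `&` B = set0].
Proof.
move=> hp bB; have := hp_measurable hp bB.
move=> /(_ measurableT [set 0%E] (emeasurable_set1 _)); rewrite setTI.
congr measurable; apply/seteqP; split => w /= /counting_eq0; exact.
Qed.

Arguments measurable_void {P lambda Phi B}.

Lemma probability_void P lambda Phi B : homogeneous_poisson P lambda Phi ->
  bounded_borel B -> P [set w | Phi w `&` B = set0] =
  (expR (- (lambda * fine (area B))))%:E.
Proof.
move=> hp bB; have /= := hp_count hp 0%N bB.
rewrite expr0 mulr1 fact0 divr1 => <-; congr (P _).
by apply/seteqP; split => w /= /counting_eq0.
Qed.

(** Without relays every rectangle [B n] is void. As [B n] has area [n], this has probability at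
    most [exp (- lambda * n)], for every [n]. *)
Lemma ae_nonempty P lambda Phi : 0 < lambda -> homogeneous_poisson P lambda Phi ->
  {ae P, forall w, Phi w !=set0}.
Proof.
move=> l0 hp.
pose B (n : nat) : set (R * R) := `[0, n%:R] `*` `[0, 1].
have mB n : measurable (B n) by apply: measurableX.
have bB n : bounded_borel (B n).
  split => //; exists (n%:R + 1); split; first exact: num_real.
  move=> M nM [x y] [/=]; rewrite !in_itv/= => /andP[x0 xn] /andP[y0 y1].
  rewrite prod_normE/= ge_max !ger0_norm//.
  have := ler0n R n; lra.
have aB n : fine (area (B n)) = n%:R.
  have -> : area (B n) = (lebesgue_measure (`[0%R, n%:R]%classic : set R) *
      lebesgue_measure (`[0%R, 1%R]%classic : set R))%E.
    exact: product_measure1E.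
  rewrite !lebesgue_measure_itv/= lte01.
  case: ifPn => [|]; rewrite lte_fin.
    by rewrite !oppr0 !adde0 mule1.
  by rewrite mul0e -leNgt lern0 => /eqP ->.
(* Emptiness of [Phi w] is not itself known to be an event; [N] is an event containing it. *)
pose N := \bigcap_n [set w | Phi w `&` B n = set0].
have mN : measurable N.
  by apply: bigcapT_measurable => n; exact: measurable_void hp (bB n).
exists N; split => //; last first.
  move=> w /= h n _ /=; apply/seteqP; split => // x [Px _].
  by apply: h; exists x.
apply/eqP; rewrite eq_le measure_ge0 andbT.
apply/lee_addgt0Pr => e e0; rewrite add0e.
(* This gives [lambda * n >= 1 / e], and [exp x >= 1 + x] then yields [exp (- lambda * n) <= e]. *)
pose n := Num.bound ((lambda * e)^-1).
apply: (@le_trans _ _ (P [set w | Phi w `&` B n = set0])).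
  apply: le_measure; rewrite ?inE//; first exact: measurable_void hp (bB n).
  by move=> w /(_ n I).
rewrite (probability_void _ _ _ _ hp)// aB lee_fin expRN.
have ln : e^-1 <= lambda * n%:R.
  have : (lambda * e)^-1 < n%:R by apply: archi_boundP; rewrite invr_ge0 mulr_ge0 ?ltW.
  have -> : e^-1 = lambda * (lambda * e)^-1 by field; rewrite !gt_eqF.
  by move=> /ltW; rewrite ler_pM2l.
rewrite invf_ple ?posrE ?expR_gt0// (le_trans ln)//.
by have := expR_ge1Dx (lambda * n%:R); lra.
Qed.

Lemma ae_ex_minimum P lambda Phi xs xd : 0 < lambda ->
  homogeneous_poisson P lambda Phi ->
  {ae P, forall w, exists m, is_minimum (shat xs xd @` Phi w) m}.
Proof.
move=> l0 hp; apply: filterS2 (hp_locally_finite hp) (ae_nonempty _ _ _ l0 hp).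
by move=> w; exact: ex_shat_minimum.
Qed.

Lemma ex_min_RV P lambda Phi xs xd : 0 < lambda ->
  homogeneous_poisson P lambda Phi ->
  exists Gamma : {RV P >-> R},
    {ae P, forall w, is_minimum (shat xs xd @` Phi w) (Gamma w)}.
Proof.
move=> l0 hp.
(* An enumeration of the rationals; a number coding no rational is sent to 0, itself a rational. *)
pose q (n : nat) : R := if unpickle n is Some r then ratr r else 0.
pose L g : set (R * R) := [set p | shat xs xd p <= g].
(* A radius whose lens holds no relay gets [+oo], so that the infimum ignores it. *)
pose u (w : Omega) (n : nat) : \bar R :=
  if nb_points Phi (L (q n)) w == 0%E then +oo%E else (q n)%:E.
(* [fine] sends an infinite infimum to 0; this can happen only where no minimum exists, hence on a
   null set. *)
pose G (w : Omega) : R := fine (einfs (u w) 0).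
have mG : measurable_fun setT G.
  apply: measurableT_comp; first exact: fine_measurable.
  apply: measurable_fun_einfs => n; apply: measurable_fun_ifT => //.
  apply: measurable_fun_eqe => //.
  exact: (hp_measurable hp (bounded_borel_shat_le _ _ _)).
pose Gamma : {RV P >-> R} := HB.pack G (isMeasurableFun.Build _ _ _ _ G mG).
exists Gamma; apply: filterS (ae_ex_minimum _ _ _ xs xd l0 hp) => w [m mm].
suff -> : Gamma w = m by [].
rewrite /Gamma /= /G.
suff -> : einfs (u w) 0 = m%:E by [].
have uE n : u w n = if m <= q n then (q n)%:E else +oo%E.
  rewrite /u; have mq := shat_minimum_le _ _ _ _ (q n) mm.
  case: eqP => [/counting_eq0 L0|L0]; case: ifPn => // mqn.
    by have := mq.1 mqn; rewrite L0 => -[].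
  exfalso; apply/L0/counting_eq0; apply: contrapT => /eqP/set0P/mq.2.
  exact/negP.
(* Rational radii just above [m] bring the infimum down to [m], and no term lies below [m]. *)
apply/eqP; rewrite eq_le; apply/andP; split.
  apply/lee_addgt0Pr => e e0.
  have : m < m + e by rewrite ltrDl.
  move=> /rat_in_itvoo[r].
  rewrite in_itv/= => /andP[mr re].
  apply: (@le_trans _ _ (ratr r)%:E); last by rewrite -EFinD lee_fin ltW.
  apply: ereal_inf_lbound; exists (pickle r) => //=.
  by rewrite uE /q pickleK ltW.
apply: le_ereal_inf_tmp => _ [n _ <-]; rewrite uE.
by case: ifPn; rewrite ?lee_fin ?leey.
Qed.

Lemma cdf_min P lambda Phi xs xd (Gamma : {RV P >-> R}) g :
  homogeneous_poisson P lambda Phi ->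
  {ae P, forall w, is_minimum (shat xs xd @` Phi w) (Gamma w)} ->
  cdf Gamma g =
  (1 - expR (- (lambda * fine (area [set p | shat xs xd p <= g]))))%:E.
Proof.
move=> hp aeG; have bL := bounded_borel_shat_le xs xd g.
rewrite EFinB -(probability_void _ _ _ _ hp bL) -probability_setC; last first.
  exact: measurable_void hp bL.
(* The two events are known to agree only where [Gamma w] is the minimum, hence almost surely. *)
apply: measure_eq_ae.
- by rewrite -[X in measurable X]setTI; exact: measurable_funP.
- exact/measurableC/(measurable_void hp bL).
apply: filterS aeG => w mw; rewrite /= in_itv/= (shat_minimum_le _ _ _ _ _ mw).
by split => [/set0P/eqP|/eqP/set0P].
Qed.

End Poisson.

Theorem theorem4 (R : realType) (disp : measure_display)
    (Omega : measurableType disp) (P : probability Omega R)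
    (lambda d : R) (xs xd : R * R) (Phi : Omega -> set (R * R))
    (lambda_gt0 : 0 < lambda) (d_gt0 : 0 < d)
    (dist_sd : enorm (xs - xd) = 2 * d)
    (Phi_poisson : homogeneous_poisson P lambda Phi) :
  (exists Gamma : {RV P >-> R},
    {ae P, forall w, is_minimum (shat xs xd @` Phi w) (Gamma w)}) /\
  (forall Gamma : {RV P >-> R},
    {ae P, forall w, is_minimum (shat xs xd @` Phi w) (Gamma w)} ->
    (forall gamma : R,
      cdf Gamma gamma =
      (if gamma < d then 0
       else 1 - expR (- (2 * lambda * d ^+ 2 *
              ((gamma / d) ^+ 2 * arcsec (gamma / d)
               - Num.sqrt ((gamma / d) ^+ 2 - 1)))))%:E) /\
    is_pdf Gamma (fun gamma : R =>
      4 * lambda * gamma * arcsec (gamma / d) *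
      expR (- (2 * lambda * d ^+ 2 *
              ((gamma / d) ^+ 2 * arcsec (gamma / d)
               - Num.sqrt ((gamma / d) ^+ 2 - 1)))) *
      \1_[set u : R | d <= u] gamma)).
Proof.
split; first exact: ex_min_RV Phi_poisson.
move=> Gamma aeG.
have areaE g : 2 * lambda * d ^+ 2 *
    ((g / d) ^+ 2 * arcsec (g / d) - Num.sqrt ((g / d) ^+ 2 - 1)) =
    lambda * lens_area d g by rewrite /lens_area; ring.
have cdfE g : cdf Gamma g =
    (if g < d then 0 else 1 - expR (- (lambda * lens_area d g)))%:E.
  rewrite (cdf_min _ _ _ _ _ _ _ Phi_poisson aeG); case: ltP => gd.
    (* Below [d] the lens is empty by [shat_ge], so the exponential is 1. *)
    rewrite (_ : [set p | _] = set0).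
      by rewrite /area measure0 mulr0 oppr0 expR0 subrr.
    apply/seteqP; split => // p /=.
    by have := shat_ge _ _ _ p d_gt0 dist_sd; lra.
  by rewrite (area_lens d).
split=> [g|]; first by rewrite areaE.
rewrite (_ : (fun g => _) = relay_density lambda d); last first.
  by apply/funext => g; rewrite areaE.
apply: is_pdf_of_cdf.
- exact: measurable_relay_density.
- by move=> x; exact: relay_density_ge0.
- by move=> x; rewrite cdfE integral_relay_density.
Qed.
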